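(* Let $d\ge 1$ and let $\mathcal{U}$ be an update family on $\mathbb{Z}^d$ that is not supercritical unrooted. Then there exists a constant $\kappa>0$ such that for every $n\in\mathbb{N}$, writing $L_n=\lfloor \kappa n 2^n\rfloor$ and $\Lambda_n=\{-L_n,\dots,L_n\}^d$, every configuration $\eta\in V(n,\Lambda_n)$ satisfies $\eta_0=1$.
   Context: Fix $d\in\mathbb{N}^*$. An update family is a set $\mathcal{U}=\{X_1,\dots,X_m\}$, $m\ge1$, where each $X_i$ is a finite nonempty subset of $\mathbb{Z}^d\setminus\{0\}$. For $\Lambda\subset\mathbb{Z}^d$, configurations are elements of $\{0,1\}^\Lambda$; $1_\Lambda$ denotes the all-ones configuration. For $\eta\in\{0,1\}^\Lambda$ and $s\in\Lambda$, $\eta^s$ is $\eta$ with the state at $s$ flipped. A move from $\eta$ to $\eta'$ (both in $\{0,1\}^\Lambda$) is legal if $\eta'=\eta$, or if $\eta'=\eta^s$ for some $s\in\Lambda$ and there is $X\in\mathcal{U}$ such that every site of $s+X$ is in state $0$ in the configuration on $\mathbb{Z}^d$ equal to $\eta$ on $\Lambda$ and to $0$ outside $\Lambda$. A legal path from $\eta$ to $\eta'$ is a sequence $(\eta^j)_{0\le j\le m}$, $m\ge1$, with $\eta^0=\eta$, $\eta^m=\eta'$ and each move $\eta^j\to\eta^{j+1}$ legal; it is $n$-legal if every $\eta^j$ has at most $n$ zeroes in $\Lambda$. $V(n,\Lambda)$ is the set of $\eta\in\{0,1\}^\Lambda$ such that there is an $n$-legal path from $1_\Lambda$ to $\eta$.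 For $u\in S^{d-1}$ let $\mathbb{H}_u=\{x\in\mathbb{R}^d:\langle x,u\rangle<0\}$; $u$ is a stable direction of $\mathcal{U}$ if there is no $X\in\mathcal{U}$ with $X\subset\mathbb{H}_u$. $\mathcal{U}$ is supercritical unrooted if some hyperplane (linear subspace of dimension $d-1$) of $\mathbb{R}^d$ contains all stable directions of $\mathcal{U}$. *)

(* Defs.v *)
From Stdlib Require Import Reals ZArith List Arith.
Import ListNotations.
Open Scope R_scope.

(* A point of Z^d is represented as a function nat -> Z that vanishes at
   every index >= d (so the representation is unique). *)
Definition pt := nat -> Z.
Definition in_Zd (d : nat) (x : pt) : Prop := forall i, (d <= i)%nat -> x i = 0%Z.
Definition origin : pt := fun _ => 0%Z.
Definition padd (x y : pt) : pt := fun i => (x i + y i)%Z.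

Definition rvec := nat -> R.
Definition in_Rd (d : nat) (u : rvec) : Prop := forall i, (d <= i)%nat -> u i = 0.

Fixpoint rdot (k : nat) (u v : rvec) : R :=
  match k with O => 0 | S k => rdot k u v + u k * v k end.
Definition zdot (d : nat) (x : pt) (u : rvec) : R := rdot d (fun i => IZR (x i)) u.

Definition in_sphere (d : nat) (u : rvec) : Prop := in_Rd d u /\ rdot d u u = 1.

Definition update_family (d : nat) (U : list (list pt)) : Prop :=
  U <> [] /\
  forall X, In X U -> X <> [] /\
    forall y, In y X -> in_Zd d y /\ y <> origin.

Definition stable_direction (d : nat) (U : list (list pt)) (u : rvec) : Prop :=
  in_sphere d u /\
  ~ (exists X, In X U /\ forall y, In y X -> zdot d y u < 0).

(* Supercritical unrooted: some hyperplane (= orthogonal complement of a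
   nonzero vector w of R^d) contains all stable directions. *)
Definition supercritical_unrooted (d : nat) (U : list (list pt)) : Prop :=
  exists w : rvec, in_Rd d w /\ (exists i, (i < d)%nat /\ w i <> 0) /\
    forall u, stable_direction d U u -> rdot d u w = 0.

(* Configurations: functions pt -> bool (true = state 1).  A configuration on
   Lambda is represented by its extension by 0 outside Lambda. *)
Definition config := pt -> bool.
Definition conf_on (Lam : pt -> Prop) (eta : config) : Prop :=
  forall x, ~ Lam x -> eta x = false.

Definition all_ones (Lam : pt -> Prop) (eta : config) : Prop :=
  conf_on Lam eta /\ forall x, Lam x -> eta x = true.

Definition at_most_zeros (n : nat) (Lam : pt -> Prop) (eta : config) : Prop :=
  forall l : list pt, NoDup l -> (forall x, In x l -> Lam x /\ eta x = false) ->
    (length l <= n)%nat.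

Definition flipped (eta : config) (s : pt) (eta' : config) : Prop :=
  eta' s = negb (eta s) /\ forall x, x <> s -> eta' x = eta x.

Definition legal_move (U : list (list pt)) (Lam : pt -> Prop) (eta eta' : config) : Prop :=
  eta' = eta \/
  exists s, Lam s /\ flipped eta s eta' /\
    exists X, In X U /\ forall y, In y X -> eta (padd s y) = false.

Inductive n_reach (U : list (list pt)) (n : nat) (Lam : pt -> Prop) : config -> Prop :=
| nr_start : forall eta, all_ones Lam eta -> at_most_zeros n Lam eta ->
    n_reach U n Lam eta
| nr_step : forall eta eta', n_reach U n Lam eta -> conf_on Lam eta' ->
    legal_move U Lam eta eta' -> at_most_zeros n Lam eta' -> n_reach U n Lam eta'.

Definition V (U : list (list pt)) (n : nat) (Lam : pt -> Prop) (eta : config) : Prop :=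
  conf_on Lam eta /\ n_reach U n Lam eta.

Definition box (d : nat) (L : Z) (x : pt) : Prop :=
  in_Zd d x /\ forall i, (i < d)%nat -> (- L <= x i <= L)%Z.

Definition Ln (kappa : R) (n : nat) : Z := Int_part (kappa * INR n * 2 ^ n).

(* Main.v *)
(* The stable directions span R^d, so finitely many of them give forms phi that
   control all coordinates, and a flip at s needs, for each phi, a nearby zero x
   (in the box or outside) with phi x >= phi s. Given a legal path and a time
   interval, link zeros that are close at the same time, or equal at consecutive
   times, and contract the exterior of the box to a single vertex. A component
   that avoids the exterior ("orphan") keeps max phi constant in time for every
   phi; hence it never dies, and n bounds the number of orphans. Let m be n minus
   the number of orphans over an interval. By induction on m, at any time the
   zeros of an orphan are within radius m below its maxima, and the other zeros
   are within radius m of the exterior. Indeed, unless the components are already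
   connected at the given time, shrink the interval around that time until one
   more orphan appears; the lost components merged through a single new site, so
   the bound at most doubles, up to an additive constant. Over the whole path,
   which starts without zeros, there are no orphans, so all zeros are within
   radius n, of order n 2^n, of the exterior. *)

Require Import Defs.
From Stdlib Require Import Reals ZArith List Arith Lra Lia Classical FunctionalExtensionality Relations Operators_Properties.
Import ListNotations.
Open Scope R_scope.

(** * Space-time components of a supported path *)

Section SpaceTime.

Variable site : Type.
Variable Out : site -> Prop.
Variable forms : list (site -> R).
Variable rho : R.

Definition adj (x y : site) : Prop :=
  forall phi, In phi forms -> Rabs (phi x - phi y) <= rho.

(** The part of a legal flip that the argument uses. Since [x <> s], the support [x] belongs to both
    [A] and [B] or to neither, so the relation is symmetric and creation and erasure of a zero are
    treated alike. *)
Definition supported_step (A B : site -> Prop) : Prop :=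
  (forall x, A x <-> B x) \/
  exists s, (forall x, x <> s -> (A x <-> B x)) /\
    forall phi, In phi forms ->
      exists x, x <> s /\ (A x \/ Out x) /\ adj x s /\ phi s <= phi x.

Lemma adj_sym (x y : site) : adj x y -> adj y x.
Proof. intros h phi hphi. rewrite Rabs_minus_sym. auto. Qed.

Lemma supported_step_sym (A B : site -> Prop) :
  supported_step A B -> supported_step B A.
Proof.
  intros [h | (s & h & hs)].
  - left. intros x. symmetry. apply h.
  - right. exists s. split.
    + intros x hx. symmetry. auto.
    + intros phi hphi. destruct (hs phi hphi) as (x & hx & [ha | ho] & hadj & hle);
        exists x; repeat split; auto.
      left. apply h; auto.
Qed.

Variable Z : nat -> site -> Prop.
Variable n : nat.
Hypothesis few : forall t l, NoDup l -> Forall (Z t) l -> (length l <= n)%nat.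
Variable T : nat.
Hypothesis steps : forall t, (t < T)%nat -> supported_step (Z t) (Z (S t)).
Hypothesis forms_nonempty : exists phi, In phi forms.
Hypothesis rho_ge0 : 0 <= rho.

(* [None] stands for the whole of [Out], contracted to a single vertex. *)
Definition vertex := option (nat * site).

Inductive edge (I : nat -> Prop) : vertex -> vertex -> Prop :=
| edge_adj t x y : I t -> Z t x -> Z t y -> adj x y ->
    edge I (Some (t, x)) (Some (t, y))
| edge_time t x : I t -> I (S t) -> Z t x -> Z (S t) x ->
    edge I (Some (t, x)) (Some (S t, x))
| edge_out t x p : I t -> Z t x -> Out p -> adj x p ->
    edge I (Some (t, x)) None.

Definition conn (I : nat -> Prop) : vertex -> vertex -> Prop :=
  clos_refl_sym_trans vertex (edge I).

Lemma conn_edge I v w : edge I v w -> conn I v w.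
Proof. intros; now apply rst_step. Qed.

Lemma conn_refl I v : conn I v v.
Proof. apply rst_refl. Qed.

Lemma conn_sym I v w : conn I v w -> conn I w v.
Proof. apply rst_sym. Qed.

Lemma conn_trans I v w u : conn I v w -> conn I w u -> conn I v u.
Proof. apply rst_trans. Qed.

Hint Resolve conn_edge conn_refl conn_sym : conn.

Lemma conn_mono (I J : nat -> Prop) v w :
  (forall t, I t -> J t) -> conn I v w -> conn J v w.
Proof.
  intros hIJ h. induction h as [v w h | | |]; eauto using conn_trans with conn.
  apply conn_edge. destruct h; econstructor; eauto.
Qed.

(** The vertices to which a zero appearing at [s] gets linked, read off at the neighbouring time
    [sigma], where [s] itself may not be a zero. *)
Definition touched (sigma : nat) (s : site) (v : vertex) : Prop :=
  match v with
  | None => exists p, Out p /\ adj p s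
  | Some (t, x) => t = sigma /\ Z sigma x /\ adj x s
  end.

Definition merged (I : nat -> Prop) sigma s (v : vertex) : Prop :=
  exists u, touched sigma s u /\ conn I v u.

Definition in_span (I : nat -> Prop) (v : vertex) : Prop :=
  match v with None => True | Some (t, _) => I t end.

(* Adding one time step can only merge components through the site created at
   that step. *)
Lemma conn_extend (I I' : nat -> Prop) (sigma tau : nat) (s : site) v w :
  (forall t, I' t <-> I t \/ t = tau) -> I sigma -> ~ I tau ->
  (forall t, I t -> S t = tau \/ S tau = t -> t = sigma) ->
  (forall x, x <> s -> Z tau x -> Z sigma x) ->
  in_span I v -> in_span I w -> conn I' v w ->
  conn I v w \/ (merged I sigma s v /\ merged I sigma s w).
Proof.
  intros hI' hsig htau hnb hs hv hw hvw.
  (* [B] is the relation to be reached. [A] extends it to time [tau]: a zero already present at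
     [sigma] is identified with its copy there, and any other zero, necessarily [s], is placed in
     the merged class. *)
  set (B := fun v u => conn I v u \/ (merged I sigma s v /\ merged I sigma s u)).
  set (A := fun v u => match v with
     | None => B v u
     | Some (t, x) => (t = tau /\ ((Z sigma x /\ B (Some (sigma, x)) u)
                      \/ (~ Z sigma x /\ merged I sigma s u)))
                      \/ (t <> tau /\ B v u) end).
  assert (hmerged : forall v w, conn I v w -> merged I sigma s v -> merged I sigma s w).
  { intros v1 w1 h (u & hu & hc). exists u. split; auto.
    eapply conn_trans; [apply conn_sym, h | exact hc]. }
  assert (hB1 : forall v w u, conn I v w -> B v u -> B w u).
  { intros v1 w1 u h [h1 | [h1 h2]].
    - left. eapply conn_trans; [apply conn_sym, h | exact h1].
    - right. split; eauto. }
  assert (hB2 : forall v u, merged I sigma s v -> (B v u <-> merged I sigma s u)).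
  { intros v1 u h. split.
    - intros [h1 | [_ h2]]; eauto.
    - intros h1. right. auto. }
  assert (hB : forall v w u, conn I v w -> (B v u <-> B w u)).
  { intros v1 w1 u h. split; apply hB1; auto with conn. }
  (* The first argument of [A] may be moved along every edge of [I']; on vertices spanned by [I],
     [A] is just [B]. *)
  assert (key : forall v w, conn I' v w -> forall u, A v u <-> A w u).
  { intros v1 w1 h. induction h as [v1 w1 h | | v1 w1 h IH | v1 w1 u1 h1 IH1 h2 IH2].
    - assert (hself : forall x, Z tau x -> ~ Z sigma x -> x = s).
      { intros x h1 h2. destruct (classic (x = s)) as [e|e]; auto.
        exfalso. apply h2, hs; auto. }
      assert (hold : forall t x u, t <> tau -> (A (Some (t, x)) u <-> B (Some (t, x)) u)).
      { intros t x u ht. unfold A. tauto. }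
      assert (hnew1 : forall x u, Z sigma x ->
         (A (Some (tau, x)) u <-> B (Some (sigma, x)) u)).
      { intros x u hx. unfold A. tauto. }
      assert (hnew2 : forall x u, ~ Z sigma x ->
         (A (Some (tau, x)) u <-> merged I sigma s u)).
      { intros x u hx. unfold A. tauto. }
      intros u. destruct h as [t x y ht hx hy hxy | t x ht ht' hx hx' | t x p ht hx hp hxp].
      + apply hI' in ht. destruct (classic (t = tau)) as [-> | ne].
        * destruct (classic (Z sigma x)) as [zx | zx];
          destruct (classic (Z sigma y)) as [zy | zy].
          -- rewrite !hnew1 by auto. apply hB. apply conn_edge. constructor; auto.
          -- rewrite (hnew1 x), (hnew2 y) by auto. apply hB2.
             exists (Some (sigma, x)). split; auto with conn.
             rewrite (hself y hy zy) in hxy. simpl. auto.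
          -- rewrite (hnew1 y), (hnew2 x) by auto. symmetry. apply hB2.
             exists (Some (sigma, y)). split; auto with conn.
             rewrite (hself x hx zx) in hxy. simpl. auto using adj_sym.
          -- rewrite !hnew2 by auto. tauto.
        * rewrite !hold by auto. apply hB. apply conn_edge. constructor; tauto.
      + apply hI' in ht. apply hI' in ht'.
        destruct (classic (t = tau)) as [e | ne].
        * subst t. destruct ht' as [ht' | e']; [| exfalso; lia].
          assert (e : S tau = sigma) by (apply hnb; auto).
          rewrite e in *.
          assert (sigma <> tau) by (intros ->; contradiction).
          rewrite (hold sigma) by auto. rewrite (hnew1 x) by auto. tauto.
        * rewrite hold by auto. destruct ht as [ht | e']; [| contradiction].
          destruct (classic (S t = tau)) as [e | ne'].
          -- assert (e1 : t = sigma) by (apply hnb; auto). subst t.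
             rewrite e. rewrite hnew1 by auto. tauto.
          -- rewrite hold by auto. apply hB. apply conn_edge. constructor; tauto.
      + change (A None u) with (B None u).
        apply hI' in ht. destruct (classic (t = tau)) as [-> | ne].
        * destruct (classic (Z sigma x)) as [zx | zx].
          -- rewrite hnew1 by auto. apply hB. apply conn_edge. econstructor; eauto.
          -- rewrite hnew2 by auto. symmetry. apply hB2.
             exists None. split; auto with conn.
             rewrite (hself x hx zx) in hxp. simpl. eauto using adj_sym.
        * rewrite hold by auto. apply hB. apply conn_edge. econstructor; eauto. tauto.
    - tauto.
    - intros u. symmetry. apply IH.
    - intros u. rewrite IH1. apply IH2. }
  assert (hAB : forall v u, in_span I v -> (A v u <-> B v u)).
  { intros [[t x]|] u h; unfold A; [| tauto].
    simpl in h. assert (t <> tau) by congruence. tauto. }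
  apply hAB; auto. apply (key v w hvw). apply hAB; auto. left. apply conn_refl.
Qed.

(** * Time intervals and the persistence of orphan components *)

Definition itv (a b t : nat) : Prop := (a <= t <= b)%nat.

Lemma steps_adjacent t t' :
  (t <= T)%nat -> (t' <= T)%nat -> (S t = t' \/ S t' = t) ->
  supported_step (Z t) (Z t').
Proof.
  intros h h' [e | e]; subst.
  - apply steps. lia.
  - apply supported_step_sym, steps. lia.
Qed.

Lemma edge_adjacent (I : nat -> Prop) t t' x :
  (S t = t' \/ S t' = t) -> I t -> I t' -> Z t x -> Z t' x ->
  conn I (Some (t, x)) (Some (t', x)).
Proof.
  intros [e | e] h h' z z'; subst.
  - apply conn_edge. now constructor.
  - apply conn_sym, conn_edge. now constructor.
Qed.

Definition orphan I v := ~ conn I v None.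

(** If [x] disappears, it is the flipped site. Its support in direction [phi] is then an adjacent
    zero present at both times; support by [Out] would link [x] to the exterior. *)
Lemma orphan_step (I : nat -> Prop) t t' x phi :
  (forall u, I u -> (u <= T)%nat) -> (S t = t' \/ S t' = t) -> I t -> I t' ->
  In phi forms -> Z t x -> orphan I (Some (t, x)) ->
  exists w, Z t' w /\ conn I (Some (t, x)) (Some (t', w)) /\ phi x <= phi w.
Proof.
  intros hT htt' ht ht' hphi hx ho.
  destruct (classic (Z t' x)) as [zx | zx].
  { exists x. repeat split; auto; [| lra]. apply edge_adjacent; auto. }
  destruct (steps_adjacent t t') as [h | (s & h & hs)]; auto.
  { exfalso. apply zx, h, hx. }
  assert (x = s) as ->.
  { destruct (classic (x = s)); auto. exfalso. apply zx, h; auto. }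
  destruct (hs phi hphi) as (y & hys & [zy | oy] & hadj & hle).
  - assert (zy' : Z t' y) by (apply h; auto).
    exists y. repeat split; auto.
    eapply conn_trans.
    + apply conn_sym, conn_edge. apply edge_adj; eauto.
    + apply edge_adjacent; auto.
  - exfalso. apply ho. apply conn_edge. econstructor; eauto using adj_sym.
Qed.

Lemma orphan_conn I v w : conn I v w -> orphan I v -> orphan I w.
Proof. intros h ho h'. apply ho. eapply conn_trans; eauto. Qed.

(* In every direction an orphan component keeps its extreme value over time:
   creating or erasing a site needs another zero at least as far out, and that
   zero belongs to the same component. *)
Lemma orphan_persists a b t t' x phi :
  (b <= T)%nat -> itv a b t -> itv a b t' -> In phi forms ->
  Z t x -> orphan (itv a b) (Some (t, x)) ->
  exists w, Z t' w /\ conn (itv a b) (Some (t, x)) (Some (t', w)) /\ phi x <= phi w.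
Proof.
  unfold itv at 1 2. intros hb ht ht' hphi hx ho.
  assert (hT : forall u, itv a b u -> (u <= T)%nat) by (unfold itv; intros; lia).
  destruct (le_lt_dec t t') as [hle | hlt].
  - assert (H : forall k, (t + k <= b)%nat -> exists w, Z (t + k) w /\
       conn (itv a b) (Some (t, x)) (Some ((t + k)%nat, w)) /\ phi x <= phi w).
    { induction k as [|k IH]; intros hk.
      - exists x. rewrite Nat.add_0_r. repeat split; auto with conn. lra.
      - destruct IH as (w & zw & cw & lw); [lia|].
        destruct (orphan_step (itv a b) (t + k) (t + S k) w phi)
          as (w' & zw' & cw' & lw'); auto; unfold itv; try lia.
        + eapply orphan_conn; eauto.
        + exists w'. repeat split; auto; [| lra]. eapply conn_trans; eauto. }
    replace t' with (t + (t' - t))%nat by lia. apply H. lia.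
  - assert (H : forall k, (a + k <= t)%nat -> exists w, Z (t - k) w /\
       conn (itv a b) (Some (t, x)) (Some ((t - k)%nat, w)) /\ phi x <= phi w).
    { induction k as [|k IH]; intros hk.
      - exists x. rewrite Nat.sub_0_r. repeat split; auto with conn. lra.
      - destruct IH as (w & zw & cw & lw); [lia|].
        destruct (orphan_step (itv a b) (t - k) (t - S k) w phi)
          as (w' & zw' & cw' & lw'); auto; unfold itv; try lia.
        + eapply orphan_conn; eauto.
        + exists w'. repeat split; auto; [| lra]. eapply conn_trans; eauto. }
    replace t' with (t - (t - t'))%nat by lia. apply H. lia.
Qed.

(** Distinct orphan components are counted through representatives at one common time, so that the
    bound on the zeros of a single configuration bounds their number. *)
Definition orphan_family I t (l : list site) : Prop :=
  (forall x, In x l -> Z t x /\ orphan I (Some (t, x))) /\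
  ForallOrdPairs (fun x y => ~ conn I (Some (t, x)) (Some (t, y))) l.

Lemma orphan_family_length I t l : orphan_family I t l -> (length l <= n)%nat.
Proof.
  intros [h1 h2]. apply (few t).
  - clear h1. induction h2 as [| x l hx h IH]; constructor; auto.
    intros hin. rewrite Forall_forall in hx. apply (hx x hin). apply conn_refl.
  - apply Forall_forall. intros x hx. now apply h1.
Qed.

Lemma orphan_family_transport a b t t' l :
  (b <= T)%nat -> itv a b t -> itv a b t' -> orphan_family (itv a b) t l ->
  exists l', orphan_family (itv a b) t' l' /\ length l' = length l.
Proof.
  intros hb ht ht' [h1 h2]. destruct forms_nonempty as (phi & hphi).
  (* The added link from new to old representatives keeps the new ones in distinct components. *)
  enough (H : exists l', orphan_family (itv a b) t' l' /\ length l' = length l /\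
    forall y, In y l' -> exists x, In x l /\ conn (itv a b) (Some (t, x)) (Some (t', y))).
  { destruct H as (l' & ? & ? & _). eauto. }
  induction h2 as [| x l hx h IH].
  { exists []. repeat split; simpl; auto; try tauto. constructor. }
  destruct IH as (l' & [hl1 hl2] & hlen & hl). { intros; apply h1; now right. }
  destruct (h1 x (or_introl eq_refl)) as [zx ox].
  destruct (orphan_persists a b t t' x phi) as (w & zw & cw & _); auto.
  exists (w :: l'). repeat split.
  - destruct H as [<- | H]; auto. now apply hl1.
  - destruct H as [<- | H]; [| now apply hl1]. eapply orphan_conn; eauto.
  - constructor; auto. apply Forall_forall. intros y hy c.
    destruct (hl y hy) as (x' & hx' & cx'). rewrite Forall_forall in hx.
    apply (hx x' hx'). eapply conn_trans; [exact cw|].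
    eapply conn_trans; [exact c|]. now apply conn_sym.
  - simpl. now rewrite hlen.
  - intros y [<- | hy].
    + exists x. split; simpl; auto.
    + destruct (hl y hy) as (x' & ? & ?). exists x'. split; simpl; auto.
Qed.

(** * Comparing the connections given by two time intervals *)

Definition at_time t (v : vertex) : Prop :=
  match v with None => True | Some (u, x) => u = t /\ Z t x end.

(** Meant for [I] inside [J]: passing to [J] creates no new link among the exterior and the zeros at
    time [t]. The converse implication is [conn_mono]. *)
Definition agree t I J : Prop :=
  forall v w, at_time t v -> at_time t w -> conn J v w -> conn I v w.

(** By contraposition: if no zero can be added to [l] over [I], every vertex at time [t] is
    [I]-connected to the exterior or to a member of [l]. These anchors lie in distinct
    [J]-components, so a [J]-connection forces equal anchors, hence an [I]-connection. *)
Lemma not_agree_more_orphans t (I J : nat -> Prop) l :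
  (forall u, I u -> J u) -> ~ agree t I J -> orphan_family J t l ->
  exists x, orphan_family I t (x :: l).
Proof.
  intros hIJ hna [h1 h2]. apply NNPP. intros hno. apply hna. intros v w hv hw hvw.
  assert (hl1 : forall x, In x l -> Z t x /\ orphan I (Some (t, x))).
  { intros x hx. destruct (h1 x hx) as [zx ox]. split; auto.
    intros c. apply ox. eapply conn_mono; eauto. }
  assert (hl2 : ForallOrdPairs (fun x y => ~ conn I (Some (t, x)) (Some (t, y))) l).
  { clear - h2 hIJ. induction h2 as [| x l hx h IH]; constructor; auto.
    rewrite Forall_forall in *. intros y hy c. apply (hx y hy).
    eapply conn_mono; eauto. }
  assert (cover : forall v, at_time t v ->
     conn I v None \/ exists x, In x l /\ conn I v (Some (t, x))).
  { intros [[u x]|] hv'; [| left; apply conn_refl]. destruct hv' as [-> zx].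
    destruct (classic (conn I (Some (t, x)) None)) as [c | ox]; auto.
    right. apply NNPP. intros hn. apply hno. exists x. split.
    - intros y [<- | hy]; auto.
    - constructor; auto. apply Forall_forall. intros y hy c. apply hn. eauto. }
  assert (pairs : forall x y, In x l -> In y l ->
     conn J (Some (t, x)) (Some (t, y)) -> x = y).
  { intros x y hx hy c.
    destruct (ForallOrdPairs_In h2 x y hx hy) as [e | [h | h]]; auto; exfalso; auto.
    apply h. now apply conn_sym. }
  destruct (cover v hv) as [cv | (x & hx & cx)];
    destruct (cover w hw) as [cw | (y & hy & cy)].
  - eapply conn_trans; eauto with conn.
  - exfalso. apply (h1 y hy). apply conn_sym.
    eapply conn_trans; [apply (conn_mono I J), conn_sym, cv; auto|].
    eapply conn_trans; [exact hvw|]. eapply conn_mono; eauto.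
  - exfalso. apply (h1 x hx).
    eapply conn_trans; [apply (conn_mono I J), conn_sym, cx; auto|].
    eapply conn_trans; [exact hvw|]. eapply conn_mono; eauto.
  - assert (x = y) as ->.
    { apply pairs; auto.
      eapply conn_trans; [apply (conn_mono I J), conn_sym, cx; auto|].
      eapply conn_trans; [exact hvw|]. eapply conn_mono; eauto. }
    eapply conn_trans; eauto with conn.
Qed.

(** Grow the interval from [t] alone, first rightwards to [b], then leftwards to [a]. Agreement
    fails at the start and holds at the end, so it is gained in some single step: [tau] is the time
    added there, [sigma] its neighbour in the shorter interval. The last clauses are what
    [conn_extend] requires. *)
Lemma maximal_not_agree a b t (J : nat -> Prop) :
  itv a b t -> (forall u, J u <-> itv a b u) -> ~ agree t (itv t t) J ->
  exists a' b' a'' b'' sigma tau,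
    (a <= a'' <= a')%nat /\ (a' <= t <= b')%nat /\ (b' <= b'' <= b)%nat /\
    ~ agree t (itv a' b') J /\ agree t (itv a'' b'') J /\
    (S sigma = tau \/ S tau = sigma) /\
    itv a' b' sigma /\ ~ itv a' b' tau /\
    (forall u, itv a'' b'' u <-> itv a' b' u \/ u = tau) /\
    (forall u, itv a' b' u -> S u = tau \/ S tau = u -> u = sigma).
Proof.
  unfold itv at 1. intros ht hJ h0. apply NNPP. intros hno.
  assert (right_ext : forall k, (t + k <= b)%nat -> ~ agree t (itv t (t + k)) J).
  { induction k as [| k IH]; intros hk.
    - now rewrite Nat.add_0_r.
    - intros hag. apply hno.
      exists t, (t + k)%nat, t, (t + S k)%nat, (t + k)%nat, (t + S k)%nat.
      assert (hk' : (t + k <= b)%nat) by lia. specialize (IH hk').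
      unfold itv in *. repeat split; auto; try lia. }
  assert (left_ext : forall k, (a + k <= t)%nat -> ~ agree t (itv (t - k) b) J).
  { induction k as [| k IH]; intros hk.
    - rewrite Nat.sub_0_r. replace b with (t + (b - t))%nat by lia. apply right_ext. lia.
    - intros hag. apply hno.
      exists (t - k)%nat, b, (t - S k)%nat, b, (t - k)%nat, (t - S k)%nat.
      assert (hk' : (a + k <= t)%nat) by lia. specialize (IH hk').
      unfold itv in *. repeat split; auto; try lia. }
  apply (left_ext (t - a)%nat); [lia|].
  replace (t - (t - a))%nat with a by lia.
  intros v w _ _ c. eapply conn_mono; [| exact c]. intros u. apply hJ.
Qed.

(* Along a chain with steps at most [rho] starting at height 0, a height above
   [n * rho] would force [n + 1] distinct zeros, one in each window
   [(k * rho, (k + 1) * rho]]. *)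
Lemma chain_height t (g : site -> R) x y :
  (forall u v, adj u v -> Rabs (g u - g v) <= rho) -> g x = 0 ->
  clos_refl_sym_trans site (fun u v => Z t u /\ Z t v /\ adj u v) x y ->
  g y <= INR n * rho.
Proof.
  intros hg hgx hc.
  (* Discrete intermediate value: windows are as wide as the largest step, so none below the final
     height is jumped over. *)
  assert (win : forall w, clos_refl_sym_trans site (fun u v => Z t u /\ Z t v /\ adj u v) x w ->
     forall k : nat, INR k * rho < g w ->
     exists u, Z t u /\ INR k * rho < g u <= INR (S k) * rho).
  { intros w hw. apply clos_rst_rstn1 in hw. induction hw as [| v w hvw _ IH]; intros k hk.
    - exfalso. pose proof (pos_INR k). nra.
    - destruct (Rlt_le_dec (INR k * rho) (g v)) as [hlt | hle]; auto.
      assert (Z t w /\ Rabs (g v - g w) <= rho) as [zw hvw'].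
      { destruct hvw as [(h1 & h2 & h3) | (h1 & h2 & h3)]; split; auto using adj_sym. }
      exists w. split; auto. split; auto. rewrite S_INR.
      unfold Rabs in hvw'; destruct Rcase_abs; lra. }
  apply Rnot_lt_le. intros hlt.
  assert (H : forall m, (m <= S n)%nat -> exists l, NoDup l /\ length l = m /\
     Forall (Z t) l /\ Forall (fun u => g u <= INR m * rho) l).
  { induction m as [| m IH]; intros hm.
    - exists []. repeat split; constructor.
    - destruct IH as (l & hnd & hlen & hZ & hgl); [lia|].
      destruct (win y hc m) as (u & zu & hu1 & hu2).
      { apply Rle_lt_trans with (INR n * rho); auto.
        apply Rmult_le_compat_r; auto. apply le_INR. lia. }
      exists (u :: l). repeat split; simpl length; auto.
      + constructor; auto. intros hin. rewrite Forall_forall in hgl.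
        specialize (hgl u hin). cbv beta in hgl. lra.
      + constructor; auto. eapply Forall_impl; [| exact hgl].
        cbv beta. intros v hv. rewrite S_INR. lra. }
  destruct (H (S n) (le_n _)) as (l & hnd & hlen & hZ & _).
  pose proof (few t l hnd hZ). lia.
Qed.

(** Without time edges, a connection is a chain of adjacent zeros unless it passes through [None].
    In that case each end other than [None] has its own chain to a zero next to [Out]. *)
Lemma conn_single_time t v w :
  conn (itv t t) v w ->
  let near u := match u with
     | None => True
     | Some (_, x) => exists y p,
         clos_refl_sym_trans site (fun u v => Z t u /\ Z t v /\ adj u v) x y /\
         Z t y /\ Out p /\ adj y p
     end in
  (near v /\ near w) \/
  match v, w with
  | Some (_, x), Some (_, y) =>
      clos_refl_sym_trans site (fun u v => Z t u /\ Z t v /\ adj u v) x y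
  | None, None => True
  | _, _ => False
  end.
Proof.
  intros h near.
  set (chain := clos_refl_sym_trans site (fun u v => Z t u /\ Z t v /\ adj u v)) in *.
  assert (hnear : forall x y i j, chain x y -> near (Some (i, x)) -> near (Some (j, y))).
  { intros x y i j hxy (y' & p & h1 & h2). exists y', p. split; auto.
    eapply rst_trans; [apply rst_sym, hxy | exact h1]. }
  induction h as [v w h | v | v w h IH | v w u h1 IH1 h2 IH2].
  - destruct h as [t' x y ht hx hy hxy | t' x ht ht' | t' x p ht hx hp hxp]; unfold itv in *.
    + replace t' with t in * by lia. right. apply rst_step. auto.
    + lia.
    + replace t' with t in * by lia. left. split; simpl; auto.
      exists x, p. repeat split; auto. apply rst_refl.
  - right. destruct v as [[i x]|]; auto. apply rst_refl.
  - destruct IH as [[? ?] | IH]; auto. right.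
    destruct v as [[i x]|], w as [[j y]|]; auto. now apply rst_sym.
  - destruct IH1 as [[n1 n2] | IH1]; destruct IH2 as [[n3 n4] | IH2]; auto.
    + left. split; auto. destruct w as [[i x]|], u as [[j y]|]; simpl; auto; try easy.
      eapply (hnear _ _ 0%nat 0%nat); eauto.
    + left. split; auto. destruct v as [[i x]|], w as [[j y]|]; simpl; auto; try easy.
      eapply (hnear _ _ 0%nat 0%nat); [| exact n3]. now apply rst_sym.
    + right. destruct v as [[i x]|], w as [[j y]|], u as [[k z]|]; auto; try easy.
      eapply rst_trans; eauto.
Qed.

(** * Confinement of the zeros, by induction on the number of missing orphans *)

(** The solution of [radius (S m) = 2 * radius m + 2 * rho] that starts from the single-time bound
    [INR n * rho + rho]. *)
Definition radius (m : nat) : R := (INR n + 3) * rho * 2 ^ m - 2 * rho.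

(** For orphans the bound is one-sided, measured from the maximum of [phi] over the component at
    time [t]: these maxima are constant in time, so heights at different times can be compared. *)
Definition confined (I : nat -> Prop) t x (E : R) : Prop :=
  (conn I (Some (t, x)) None -> exists p, Out p /\
     forall phi, In phi forms -> Rabs (phi x - phi p) <= E) /\
  (orphan I (Some (t, x)) -> forall w phi, Z t w -> In phi forms ->
     conn I (Some (t, x)) (Some (t, w)) -> phi w - phi x <= E).

Lemma Rabs_le_iff x y : Rabs x <= y <-> -y <= x <= y.
Proof. unfold Rabs; destruct Rcase_abs; split; lra. Qed.

(** [chain_height] for the distance to [x] in each form gives [INR n * rho]; the last link to [Out]
    costs one more [rho]. *)
Lemma confined_single_time t x (J : nat -> Prop) :
  Z t x -> (forall u, itv t t u -> J u) -> agree t (itv t t) J ->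
  confined J t x (INR n * rho + rho).
Proof.
  intros zx hJ hag.
  assert (H : forall y, clos_refl_sym_trans site (fun u v => Z t u /\ Z t v /\ adj u v) x y ->
    forall phi, In phi forms -> Rabs (phi y - phi x) <= INR n * rho).
  { intros y hy phi hphi.
    apply (chain_height t (fun y => Rabs (phi y - phi x)) x y); auto.
    - intros u v huv. specialize (huv phi hphi).
      eapply Rle_trans; [apply Rabs_triang_inv2|].
      replace (phi u - phi x - (phi v - phi x)) with (phi u - phi v) by ring. exact huv.
    - rewrite Rminus_diag. apply Rabs_R0. }
  split.
  - intros c. apply hag in c; simpl; auto.
    apply conn_single_time in c. destruct c as [[(y & p & hc & zy & hp & hyp) _] | []].
    exists p. split; auto. intros phi hphi.
    specialize (H y hc phi hphi). specialize (hyp phi hphi).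
    apply Rabs_le_iff in H, hyp. apply Rabs_le_iff. lra.
  - intros ho w phi zw hphi c. apply hag in c; simpl; auto.
    apply conn_single_time in c. destruct c as [[(y & p & hc & zy & hp & hyp) _] | c].
    + exfalso. apply ho. apply (conn_mono (itv t t) J); auto.
      apply conn_trans with (Some (t, y)).
      * clear - hc. induction hc as [u v (h1 & h2 & h3) | | |]; eauto using conn_trans with conn.
        apply conn_edge. constructor; auto. unfold itv; lia.
      * apply conn_edge. econstructor; eauto. unfold itv; lia.
    + specialize (H w c phi hphi). apply Rabs_le_iff in H. lra.
Qed.

Lemma confined_le I t x E E' : E <= E' -> confined I t x E -> confined I t x E'.
Proof.
  intros hE [h1 h2]. split.
  - intros c. destruct (h1 c) as (p & hp & h). exists p. split; auto.
    intros phi hphi. specialize (h phi hphi). lra.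
  - intros ho w phi zw hphi c. specialize (h2 ho w phi zw hphi c). lra.
Qed.

(** A new connection runs through the neighbourhood of [s] at time [sigma]: it costs [E] on each
    side to reach a vertex next to [s], or from there the exterior, and [2 * rho] to cross between
    the two vertices next to [s]. *)
Lemma confined_merge a b t sigma s (J : nat -> Prop) x E :
  (b <= T)%nat -> (forall u, itv a b u -> J u) ->
  itv a b t -> itv a b sigma -> 0 <= E ->
  (forall u y, itv a b u -> Z u y -> confined (itv a b) u y E) ->
  (forall v w, at_time t v -> at_time t w -> conn J v w ->
     conn (itv a b) v w \/
     (merged (itv a b) sigma s v /\ merged (itv a b) sigma s w)) ->
  Z t x -> confined J t x (2 * E + 2 * rho).
Proof.
  intros hb hJ ht hsig hE IH hmerge zx. set (I := itv a b) in *.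
  assert (hm : forall v, merged I sigma s v -> orphan I v ->
    exists y, Z sigma y /\ adj y s /\ conn I v (Some (sigma, y))).
  { intros v ([[u y]|] & hu & c) ho; [| contradiction].
    destruct hu as (-> & zy & hy). exists y. auto. }
  (* By persistence the component has at time [u'] a zero at least as high as [y], and [z] is at
     most [E] below that zero. *)
  assert (drift : forall u u' y z phi, I u -> I u' -> Z u y -> Z u' z -> In phi forms ->
     orphan I (Some (u, y)) -> conn I (Some (u, y)) (Some (u', z)) -> phi y <= phi z + E).
  { intros u u' y z phi hu hu' zy zz hphi ho c.
    destruct (orphan_persists a b u u' y phi) as (w & zw & cw & lw); auto.
    destruct (IH u' z hu' zz) as [_ h].
    enough (phi w - phi z <= E) by lra.
    apply h; auto.
    - eapply orphan_conn; eauto.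
    - eapply conn_trans; [apply conn_sym, c | exact cw]. }
  split.
  - intros c. destruct (classic (conn I (Some (t, x)) None)) as [cx | ox].
    { destruct (confined_le I t x E (2 * E + 2 * rho)) as [h _]; auto. lra. }
    destruct (hmerge (Some (t, x)) None) as [c' | [mx mo]]; simpl; auto; [contradiction|].
    destruct (hm _ mx ox) as (y & zy & ay & cy).
    assert (hxy : forall phi, In phi forms -> Rabs (phi x - phi y) <= E).
    { intros phi hphi. apply Rabs_le_iff.
      pose proof (drift t sigma x y phi ht hsig zx zy hphi ox cy).
      pose proof (drift sigma t y x phi hsig ht zy zx hphi
        (orphan_conn _ _ _ cy ox) (conn_sym _ _ _ cy)). lra. }
    (* The exterior component reaches [s] through a zero [z], or directly through a point [p] of
       [Out], which then serves as its own [z]. *)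
    assert (hz : exists z p, Out p /\ adj z s /\
       forall phi, In phi forms -> Rabs (phi z - phi p) <= E).
    { destruct mo as ([[u z]|] & hu & cz).
      - destruct hu as (-> & zz & az).
        destruct (IH sigma z hsig zz) as [h _].
        destruct (h (conn_sym _ _ _ cz)) as (p & hp & h'). eauto.
      - destruct hu as (p & hp & ap). exists p, p. repeat split; auto.
        intros phi _. rewrite Rminus_diag, Rabs_R0. exact hE. }
    destruct hz as (z & p & hp & az & hzp). exists p. split; auto.
    intros phi hphi. specialize (hxy phi hphi). specialize (hzp phi hphi).
    specialize (az phi hphi). specialize (ay phi hphi).
    apply Rabs_le_iff in hxy, hzp, az, ay. apply Rabs_le_iff. lra.
  - intros oJ w phi zw hphi c.
    assert (ho : forall v, conn J (Some (t, x)) v -> orphan I v).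
    { intros v cv c'. apply oJ. eapply conn_trans; [exact cv|]. eapply conn_mono; eauto. }
    assert (ox := ho _ (conn_refl _ _)). assert (ow := ho _ c).
    destruct (hmerge (Some (t, x)) (Some (t, w))) as [c' | [mx mw]]; simpl; auto.
    { pose proof (drift t t w x phi ht ht zw zx hphi ow (conn_sym _ _ _ c')). lra. }
    destruct (hm _ mx ox) as (y & zy & ay & cy).
    destruct (hm _ mw ow) as (z & zz & az & cz).
    pose proof (drift t sigma w z phi ht hsig zw zz hphi ow cz).
    pose proof (drift sigma t y x phi hsig ht zy zx hphi
        (orphan_conn _ _ _ cy ox) (conn_sym _ _ _ cy)).
    specialize (az phi hphi). specialize (ay phi hphi).
    apply Rabs_le_iff in az, ay. lra.
Qed.

(** Here [m] is [n] minus the number of known orphans. The representatives may sit at any time [t0],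
    since they can be transported to the time [t] at which the interval is shrunk. *)
Lemma confined_radius m : forall a b t0 l,
  (b <= T)%nat -> itv a b t0 -> orphan_family (itv a b) t0 l ->
  (length l + m = n)%nat ->
  forall t x, itv a b t -> Z t x -> confined (itv a b) t x (radius m).
Proof.
  assert (hrad : forall m, INR n * rho + rho <= radius m /\ radius (S m) = 2 * radius m + 2 * rho).
  { intros k. unfold radius. split; [| simpl; ring].
    pose proof (pos_INR n). assert (1 <= 2 ^ k) by (apply pow_R1_Rle; lra).
    assert (0 <= (INR n + 3) * rho) by (apply Rmult_le_pos; lra). nra. }
  assert (hn : 0 <= INR n * rho) by (apply Rmult_le_pos; auto; apply pos_INR).
  induction m as [| m IH]; intros a b t0 l hb ht0 hl hlen t x ht zx;
    (destruct (classic (agree t (itv t t) (itv a b))) as [hag | hna];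
     [ apply confined_le with (INR n * rho + rho); [apply hrad|];
       apply confined_single_time; auto; unfold itv in *; intros; lia |]);
    destruct (maximal_not_agree a b t (itv a b)) as
      (a' & b' & a'' & b'' & sigma & tau & ha & hab & hb' & hna' & hag & hst & hsig & htau & hext & hnb);
      auto; try tauto;
    (assert (hsub : forall u, itv a' b' u -> itv a b u) by (unfold itv; intros; lia));
    destruct (orphan_family_transport a b t0 t l) as (l' & hl' & hlen'); auto;
    destruct (not_agree_more_orphans t (itv a' b') (itv a b) l') as (y & hy); auto.
  (* For [m = 0] there are already [n] orphans, and one more is impossible. *)
  - apply orphan_family_length in hy. simpl in hy. lia.
  - rewrite (proj2 (hrad m)).
    assert (hIH : forall u y, itv a' b' u -> Z u y -> confined (itv a' b') u y (radius m)).
    { apply (IH a' b' t (y :: l')); auto; try lia. simpl. lia. }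
    (* [s] is the site flipped between [sigma] and [tau]; if nothing changes there, any site will
       do. *)
    assert (hnew : exists s, forall x, x <> s -> Z tau x -> Z sigma x).
    { destruct (steps_adjacent sigma tau) as [h | (s & h & _)]; auto.
      - unfold itv in hsig; lia.
      - assert (itv a'' b'' tau) by (apply hext; auto). unfold itv in *; lia.
      - exists x. intros z _ hz. now apply h.
      - exists s. intros z hz1 hz2. now apply h. }
    destruct hnew as (s & hs).
    apply (confined_merge a' b' t sigma s); auto; try lia.
    + pose proof (proj1 (hrad m)). lra.
    (* By agreement at time [t], a connection over the whole interval already exists over the one
       that is only one step longer than [itv a' b']. *)
    + intros v w hv hw c.
      assert (hspan : forall v, at_time t v -> in_span (itv a' b') v).
      { intros [[u z]|]; simpl; auto. intros [-> _]. auto. }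
      apply (conn_extend (itv a' b') (itv a'' b'') sigma tau s); auto.
Qed.

(** An orphan would persist back to time 0, where there are no zeros. Hence every zero is linked to
    the exterior, and the empty family gives [m = n]. *)
Lemma zeros_near_outside :
  (forall x, ~ Z 0 x) -> forall x, Z T x ->
  exists p, Out p /\ forall phi, In phi forms -> Rabs (phi x - phi p) <= radius n.
Proof.
  intros h0 x zx.
  destruct (confined_radius n 0 T 0 []) with (t := T) (x := x) as [h _]; auto;
    unfold itv; try lia.
  { split; [intros ? [] | constructor]. }
  apply h. apply NNPP. intros ho. destruct forms_nonempty as (phi & hphi).
  destruct (orphan_persists 0 T T 0 x phi) as (w & zw & _); auto; unfold itv; try lia.
  exact (h0 w zw).
Qed.

End SpaceTime.

(** * Forms given by the stable directions *)

Lemma rdot_comm k u v : rdot k u v = rdot k v u.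
Proof. induction k as [| k IH]; simpl; [reflexivity | rewrite IH; ring]. Qed.

Lemma rdot_ext k u u' v v' :
  (forall i, (i < k)%nat -> u i = u' i) -> (forall i, (i < k)%nat -> v i = v' i) ->
  rdot k u v = rdot k u' v'.
Proof.
  induction k as [| k IH]; simpl; intros hu hv; auto.
  rewrite IH, hu, hv by auto. reflexivity.
Qed.

Lemma rdot_lin k u v c w :
  rdot k (fun i => u i + c * v i) w = rdot k u w + c * rdot k v w.
Proof. induction k as [| k IH]; simpl; [| rewrite IH]; ring. Qed.

Lemma rdot_zero k u v : (forall i, (i < k)%nat -> v i = 0) -> rdot k u v = 0.
Proof.
  induction k as [| k IH]; simpl; intros h; auto. rewrite IH, h by auto. ring.
Qed.

(* Gaussian elimination: a form [phi] of the family with nonzero last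
   coefficient is used to eliminate the last coordinate from all others. *)
Lemma separating_family_coercive k : forall F : rvec -> Prop,
  (forall a, (forall phi, F phi -> rdot k phi a = 0) -> forall i, (i < k)%nat -> a i = 0) ->
  exists (l : list rvec) (C : R), 0 <= C /\ Forall F l /\
    forall a M, 0 <= M -> (forall phi, In phi l -> Rabs (rdot k phi a) <= M) ->
      forall i, (i < k)%nat -> Rabs (a i) <= C * M.
Proof.
  induction k as [| k IH]; intros F hF.
  { exists [], 0. repeat split; auto; try lra; intros; lia. }
  assert (hphi : exists phi, F phi /\ phi k <> 0).
  { apply NNPP. intros hno.
    (* If all forms had zero last coefficient, they would all vanish on the last basis vector. *)
    set (e := fun i => if Nat.eq_dec i k then 1 else 0).
    assert (he : forall i, (i < k)%nat -> e i = 0).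
    { intros i hi. unfold e. destruct Nat.eq_dec; auto; lia. }
    assert (hek : e k = 1) by (unfold e; destruct Nat.eq_dec; auto; lia).
    enough (e k = 0) by lra. apply hF; [| lia].
    intros phi hphi. simpl. rewrite rdot_zero, hek by auto.
    enough (phi k = 0) by lra. apply NNPP. intros h. apply hno. eauto. }
  destruct hphi as (phi & Fphi & hphik).
  set (elim := fun (psi : rvec) i => psi i + - (psi k / phi k) * phi i).
  destruct (IH (fun chi => exists psi, F psi /\ chi = elim psi)) as (l & C & hC & hl & hb).
  { intros a ha i hi.
    (* The last coordinate is chosen so that [phi] vanishes on [a']; then [psi] takes on [a'] the
       value of [elim psi] on [a], which is 0. *)
    set (a' := fun j => if Nat.eq_dec j k then - rdot k phi a / phi k else a j).
    assert (ha' : forall j, (j < k)%nat -> a' j = a j).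
    { intros j hj. unfold a'. destruct Nat.eq_dec; auto; lia. }
    assert (hak : a' k = - rdot k phi a / phi k).
    { unfold a'. destruct Nat.eq_dec; auto; lia. }
    rewrite <- ha' by auto. apply hF; [| lia]. intros psi Fpsi. simpl.
    rewrite (rdot_ext k psi psi a' a), hak by auto.
    specialize (ha (elim psi) (ex_intro _ psi (conj Fpsi eq_refl))).
    unfold elim in ha. rewrite rdot_lin in ha.
    replace (rdot k psi a) with (psi k / phi k * rdot k phi a) by lra. field. auto. }
  assert (hpsi : exists l' D, 0 <= D /\ Forall F l' /\ forall chi, In chi l ->
     exists psi, In psi l' /\ chi = elim psi /\ Rabs (psi k / phi k) <= D).
  { clear - hl. induction l as [| chi l IHl].
    - exists [], 0. repeat split; auto; try lra. intros _ [].
    - inversion hl as [| ? ? (psi & Fpsi & e) hl']; subst.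
      destruct (IHl hl') as (l' & D & hD & hF' & h).
      exists (psi :: l'), (D + Rabs (psi k / phi k)).
      pose proof (Rabs_pos (psi k / phi k)).
      repeat split; auto; [lra|]. intros chi [<- | hin].
      + exists psi. repeat split; simpl; auto. lra.
      + destruct (h chi hin) as (psi' & h1 & h2 & h3).
        exists psi'. repeat split; simpl; auto. lra. }
  destruct hpsi as (l' & D & hD & hl' & hlD).
  set (B := rdot k (fun i => Rabs (phi i)) (fun _ => 1)).
  assert (hB : forall a M, (forall i, (i < k)%nat -> Rabs (a i) <= M) ->
     Rabs (rdot k phi a) <= B * M).
  { unfold B. clear. intros a M. induction k as [| k IH]; simpl; intros h.
    - rewrite Rabs_R0. lra.
    - eapply Rle_trans; [apply Rabs_triang|]. rewrite Rabs_mult.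
      specialize (IH (fun i hi => h i (Nat.lt_lt_succ_r _ _ hi))).
      specialize (h k (Nat.lt_succ_diag_r k)).
      pose proof (Rabs_pos (phi k)). nra. }
  assert (hB0 : 0 <= B).
  { unfold B. clear. induction k as [| k IH]; simpl; [lra|].
    pose proof (Rabs_pos (phi k)). lra. }
  (* [C1] serves the first [k] coordinates, eliminated forms being at most [(1 + D) * M]. [C2]
     serves the last one, solved from the value of [phi], with [B] the sum of the other absolute
     coefficients of [phi]. *)
  set (C1 := C * (1 + D)).
  assert (hC1 : 0 <= C1) by (unfold C1; apply Rmult_le_pos; lra).
  set (C2 := (1 + B * C1) / Rabs (phi k)).
  assert (hpk : 0 < Rabs (phi k)) by now apply Rabs_pos_lt.
  assert (hC2 : 0 <= C2).
  { unfold C2. apply Rmult_le_pos; [| left; now apply Rinv_0_lt_compat].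
    assert (0 <= B * C1) by now apply Rmult_le_pos. lra. }
  exists (phi :: l'), (C1 + C2). split; [lra|]. split; [auto|].
  intros a M hM h.
  assert (h1 : forall i, (i < k)%nat -> Rabs (a i) <= C1 * M).
  { intros i hi. unfold C1. rewrite Rmult_assoc. apply hb; auto.
    - apply Rmult_le_pos; lra.
    - intros chi hchi. destruct (hlD chi hchi) as (psi & hin & -> & hD').
      pose proof (h phi (or_introl eq_refl)) as e1.
      pose proof (h psi (or_intror hin)) as e2. simpl in e1, e2.
      unfold elim. rewrite rdot_lin.
      replace (rdot k psi a + - (psi k / phi k) * rdot k phi a) with
        ((rdot k psi a + psi k * a k) - (psi k / phi k) * (rdot k phi a + phi k * a k))
        by (field; auto).
      eapply Rle_trans; [apply Rabs_triang|]. rewrite Rabs_Ropp, Rabs_mult.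
      pose proof (Rabs_pos (psi k / phi k)).
      pose proof (Rabs_pos (rdot k phi a + phi k * a k)). nra. }
  intros i hi. rewrite Rmult_plus_distr_r.
  assert (0 <= C1 * M) by now apply Rmult_le_pos.
  assert (0 <= C2 * M) by now apply Rmult_le_pos.
  destruct (Nat.eq_dec i k) as [-> | ne].
  - enough (Rabs (a k) <= C2 * M) by lra.
    pose proof (h phi (or_introl eq_refl)) as e1. simpl in e1.
    pose proof (hB a (C1 * M) h1) as e2.
    assert (e3 : Rabs (phi k) * Rabs (a k) <= M + B * (C1 * M)).
    { rewrite <- Rabs_mult.
      replace (phi k * a k) with ((rdot k phi a + phi k * a k) - rdot k phi a) by ring.
      eapply Rle_trans; [apply Rabs_triang|]. rewrite Rabs_Ropp. lra. }
    apply Rmult_le_reg_l with (Rabs (phi k)); auto.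
    eapply Rle_trans; [exact e3|]. right. unfold C2. field. lra.
  - specialize (h1 i). assert (Rabs (a i) <= C1 * M) by (apply h1; lia). lra.
Qed.

(** A nonzero vector orthogonal to all stable directions would be the normal of a hyperplane
    containing them. *)
Lemma stable_directions_coercive (d : nat) (U : list (list pt)) :
  ~ supercritical_unrooted d U ->
  exists (l : list rvec) (C : R), 0 <= C /\ Forall (stable_direction d U) l /\
    forall (x : pt) M, 0 <= M -> (forall u, In u l -> Rabs (zdot d x u) <= M) ->
      forall i, (i < d)%nat -> Rabs (IZR (x i)) <= C * M.
Proof.
  intros hU. destruct (separating_family_coercive d (stable_direction d U))
    as (l & C & hC & hl & h).
  - intros a ha i hi. apply NNPP. intros hai. apply hU.
    exists (fun j => if lt_dec j d then a j else 0). repeat split.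
    + intros j hj. destruct lt_dec; auto; lia.
    + exists i. split; auto. destruct lt_dec; auto; lia.
    + intros u hu. rewrite <- (ha u hu). apply rdot_ext; auto.
      intros j hj. destruct lt_dec; auto; lia.
  - exists l, C. repeat split; auto. intros x M hM hx. apply h; auto.
    intros u hu. rewrite rdot_comm. now apply hx.
Qed.

Lemma zdot_padd d x y u : zdot d (padd x y) u = zdot d x u + zdot d y u.
Proof.
  unfold zdot. induction d as [| d IH]; simpl; [ring|].
  rewrite IH. unfold padd at 1. rewrite plus_IZR. ring.
Qed.

Lemma zdot_origin d u : zdot d origin u = 0.
Proof. unfold zdot. induction d as [| d IH]; simpl; [reflexivity | rewrite IH; unfold origin; ring]. Qed.

Lemma list_bound (A : Type) (g : A -> R) (l : list A) :
  exists M, 0 <= M /\ forall x, In x l -> g x <= M.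
Proof.
  induction l as [| x l (M & hM & h)].
  - exists 0. split; [lra | intros _ []].
  - exists (Rmax M (g x)). pose proof (Rmax_l M (g x)). pose proof (Rmax_r M (g x)).
    split; [lra|]. intros y [<- | hy]; auto. specialize (h y hy). lra.
Qed.

(** * Application to legal paths *)

(** The path is continued by its final configuration after time [T], so that the bound on zeros
    holds at every time. *)
Lemma n_reach_path U n Lam eta :
  n_reach U n Lam eta ->
  exists (T : nat) (p : nat -> config), p T = eta /\ all_ones Lam (p 0%nat) /\
    (forall t, conf_on Lam (p t) /\ at_most_zeros n Lam (p t)) /\
    forall t, (t < T)%nat -> legal_move U Lam (p t) (p (S t)).
Proof.
  induction 1 as [eta h1 h2 | eta eta' h (T & p & hT & h0 & hz & hm) hc hl ha].
  - exists 0%nat, (fun _ => eta). split; [auto|]. split; [auto|].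
    split; [| intros; lia]. intros _. split; auto. apply h1.
  - exists (S T), (fun t => if le_dec t T then p t else eta'). repeat split.
    + destruct le_dec; auto; lia.
    + destruct le_dec; [apply h0 | lia].
    + destruct le_dec; [apply h0 | lia].
    + destruct le_dec; [apply hz | auto].
    + destruct le_dec; [apply hz | auto].
    + intros t ht. destruct (le_dec t T); [| lia]. destruct (le_dec (S t) T).
      * apply hm. lia.
      * replace t with T by lia. rewrite hT. auto.
Qed.

(** For a stable [u], some [y] in the update set [X] has nonnegative product with [u]. Then
    [padd s y] is in state 0, inside [Lam] or outside it, is no lower than [s], and differs from [s]
    because [y] is nonzero. *)
Lemma legal_move_supported d U Lam us rho eta eta' :
  (forall x, Lam x -> in_Zd d x) -> conf_on Lam eta ->
  update_family d U -> Forall (stable_direction d U) us ->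
  (forall u X y, In u us -> In X U -> In y X -> Rabs (zdot d y u) <= rho) ->
  legal_move U Lam eta eta' ->
  supported_step pt (fun x => in_Zd d x /\ ~ Lam x) (map (fun u x => zdot d x u) us) rho
    (fun x => Lam x /\ eta x = false) (fun x => Lam x /\ eta' x = false).
Proof.
  intros hLam hconf [_ hU] hus hrho [-> | (s & hs & [_ hflip] & X & hX & hzero)].
  - left. tauto.
  - right. exists s. split.
    + intros x hx. now rewrite hflip.
    + intros phi hphi. apply in_map_iff in hphi. destruct hphi as (u & <- & hu).
      rewrite Forall_forall in hus. destruct (hus u hu) as [_ hst].
      assert (hy : exists y, In y X /\ 0 <= zdot d y u).
      { apply NNPP. intros hno. apply hst. exists X. split; auto.
        intros y hy. apply Rnot_le_lt. intros hle. apply hno. eauto. }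
      destruct hy as (y & hyX & hyu). destruct (hU X hX) as [_ hXy].
      destruct (hXy y hyX) as [hyd hy0].
      exists (padd s y). repeat split.
      * intros e. apply hy0. apply functional_extensionality.
        intros i. apply (f_equal (fun x => x i)) in e. unfold padd, origin in *. lia.
      * destruct (classic (Lam (padd s y))); [left | right]; split; auto.
        intros i hi. unfold padd. rewrite (hLam s hs i hi), (hyd i hi). reflexivity.
      * intros psi hpsi. apply in_map_iff in hpsi. destruct hpsi as (v & <- & hv).
        rewrite zdot_padd.
        replace (zdot d s v + zdot d y v - zdot d s v) with (zdot d y v) by ring. eauto.
      * rewrite zdot_padd. lra.
Qed.

Theorem theorem2p4 (d : nat) (U : list (list pt)) :
  (1 <= d)%nat ->
  update_family d U ->
  ~ supercritical_unrooted d U ->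
  exists kappa : R, kappa > 0 /\
    forall (n : nat) (eta : config),
      V U n (box d (Ln kappa n)) eta -> eta origin = true.
Proof.
  intros hd hU hrooted.
  destruct (stable_directions_coercive d U hrooted) as (us & C & hC & hus & hcoer).
  assert (hrho : exists rho, 0 <= rho /\ forall u X y, In u us -> In X U -> In y X ->
     Rabs (zdot d y u) <= rho).
  { destruct (list_bound _ (fun p => Rabs (zdot d (snd p) (fst p)))
      (list_prod us (concat U))) as (rho & h0 & h).
    exists rho. split; auto. intros u X y hu hX hy.
    apply (h (u, y)). apply in_prod; auto. apply in_concat. eauto. }
  destruct hrho as (rho & hrho0 & hrho).
  (* With no forms, coercivity at [M = 0] would make the all-ones vector vanish, against
     [1 <= d]. *)
  assert (hne : us <> []).
  { intros ->. assert (h := hcoer (fun _ => 1%Z) 0 (Rle_refl 0)).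
    enough (Rabs (IZR 1) <= C * 0) by (rewrite Rabs_R1 in *; lra).
    apply (h (fun u hu => match hu with end) 0%nat). lia. }
  (* The factor 4 comes from [n + 3 <= 4 * n] for [n >= 1]; the summand 1 keeps the constant
     positive when [C * rho = 0]. *)
  exists (4 * (C * rho) + 1).
  assert (hCr : 0 <= C * rho) by now apply Rmult_le_pos.
  split; [lra|]. intros n eta [_ hreach].
  set (kappa := 4 * (C * rho) + 1) in *.
  set (Lam := box d (Ln kappa n)) in *.
  assert (hpow : 0 < 2 ^ n) by (apply pow_lt; lra).
  assert (hL : (0 <= Ln kappa n)%Z).
  { unfold Ln. apply Zlt_succ_le. apply lt_IZR. unfold Z.succ. rewrite plus_IZR.
    pose proof (base_Int_part (kappa * INR n * 2 ^ n)).
    assert (0 <= kappa * INR n * 2 ^ n).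
    { repeat apply Rmult_le_pos; try lra; [unfold kappa; lra | apply pos_INR]. }
    lra. }
  assert (horigin : Lam origin).
  { split; [intros i _; reflexivity|]. intros i _. unfold origin. lia. }
  destruct (n_reach_path _ _ _ _ hreach) as (T & p & hT & [_ h0] & hz & hm).
  destruct (eta origin) eqn:heta; auto. exfalso.
  (* The zero at the origin is itself counted by [n]. *)
  assert (hn : (1 <= n)%nat).
  { destruct (hz T) as [_ hzT]. rewrite hT in hzT. apply (hzT [origin]).
    - constructor; auto. constructor.
    - intros x [<- | []]. auto. }
  destruct (zeros_near_outside pt (fun x => in_Zd d x /\ ~ Lam x)
    (map (fun u x => zdot d x u) us) rho (fun t x => Lam x /\ p t x = false) n)
    with (T := T) (x := origin) as (q & [hqd hq] & hclose); auto.
  - intros t l hnd hl. destruct (hz t) as [_ hzt]. apply hzt; auto.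
    now apply Forall_forall.
  - intros t ht. apply legal_move_supported with U; auto.
    + now intros x [hx _].
    + apply hz.
  - destruct us as [| u us']; [contradiction|]. eexists. now left.
  - intros x [hx e]. rewrite h0 in e by auto. discriminate.
  - now rewrite hT.
  - set (E := (INR n + 3) * rho * 2 ^ n).
    assert (hn1 : 1 <= INR n) by (apply (le_INR 1); auto).
    assert (hE : 0 <= E) by (unfold E; repeat apply Rmult_le_pos; lra).
    assert (hqi : forall i, (i < d)%nat -> Rabs (IZR (q i)) <= C * E).
    { apply hcoer; auto. intros u hu.
      specialize (hclose _ (in_map (fun u x => zdot d x u) _ _ hu)).
      cbv beta in hclose. rewrite zdot_origin in hclose.
      unfold radius in hclose. fold E in hclose.
      rewrite Rminus_0_l, Rabs_Ropp in hclose. lra. }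
    (* The coordinates of [q] are integers of absolute value at most [kappa * INR n * 2 ^ n], hence
       at most its integer part: [q] would lie in the box. *)
    apply hq. split; auto. intros i hi. specialize (hqi i hi).
    apply Rabs_le_iff in hqi.
    pose proof (base_Int_part (kappa * INR n * 2 ^ n)) as [_ hint].
    fold (Ln kappa n) in hint.
    assert (hCE : C * E <= kappa * INR n * 2 ^ n).
    { unfold E, kappa. replace (C * ((INR n + 3) * rho * 2 ^ n))
        with ((C * rho * (INR n + 3)) * 2 ^ n) by ring.
      apply Rmult_le_compat_r; [lra|]. nra. }
    split; apply Zlt_succ_le; apply lt_IZR; unfold Z.succ; rewrite plus_IZR;
      try rewrite opp_IZR; lra.
Qed.
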